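(* Let $Q\subseteq\{0,1\}^n$, let $B=(N,A)$ be a decision diagram that exactly represents $Q$, and let $\boldsymbol{\pi}^\top \mathbf{z}\le\pi_0$ be an inequality valid for $\operatorname{conv}(Q)$ whose face $F(\boldsymbol{\pi})=\{\mathbf{z}\in\operatorname{conv}(Q):\boldsymbol{\pi}^\top\mathbf{z}=\pi_0\}$ is nonempty. Then the algorithm DD-DimensionCertificate, applied to $B$ and $\boldsymbol{\pi}^\top\mathbf{z}\le\pi_0$, returns the dimension of $F(\boldsymbol{\pi})$; that is, $\operatorname{rank}(\mathcal{M})=\dim F(\boldsymbol{\pi})$ for the final collection $\mathcal{M}$ of vectors built by the algorithm.
   Context: Decision diagrams. A (binary) decision diagram $B=(N,A)$ is a finite layered directed acyclic multigraph with node layers $N_1=\{r\},N_2,\ldots,N_n,N_{n+1}=\{t\}$ (root $r$, terminal $t$). Each arc $a\in A$ goes from a node of some layer $N_i$ to a node of layer $N_{i+1}$, has associated variable $\operatorname{var}(a)=i$ (the $i$-th coordinate), and a label $\operatorname{val}(a)\in\{0,1\}$; every node has at most one outgoing arc with value $0$ and at most one with value $1$. An $r$–$t$ path $(a_1,\ldots,a_n)$ encodes the point $(\operatorname{val}(a_1),\ldots,\operatorname{val}(a_n))\in\{0,1\}^n$. $B$ exactly represents $Q$ if the set of points encoded by its $r$–$t$ paths is $Q$. Notation. For $a\in A$ let $\chi(a)=\mathbf{e}^{\operatorname{var}(a)}\in\mathbb{R}^n$ (canonical unit vector) if $\operatorname{val}(a)=1$ and $\chi(a)=\mathbf{0}$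 otherwise. The length of an arc is $\ell_\pi(a)=\boldsymbol{\pi}^\top\chi(a)$. An $r$–$t$ path is tight if its total length is $\pi_0$. An arc $a=(u,u')$ is tight if it belongs to at least one tight $r$–$t$ path (equivalently, the longest $r$–$t$ path through $a$ has length $\pi_0$). Let $A^\pi_i$ be the set of tight arcs leaving layer $N_i$, $A^\pi=\bigcup_{i=1}^nA^\pi_i$, and $N^\pi=\{r\}\cup\{u\in N: \text{some arc of }A^\pi\text{ enters }u\}$. Algorithm DD-DimensionCertificate (input: $B$ and $\boldsymbol{\pi}^\top\mathbf{z}\le\pi_0$). Build the sub-diagram $B^\pi=(N^\pi,A^\pi)$. Set $\operatorname{rep}[u]$ undefined for all $u\in N^\pi\setminus\{r\}$, $\operatorname{rep}[r]=\mathbf{0}$, and $\mathcal{M}=\emptyset$. For each layer $i=1,\ldots,n$ in increasing order, and for each arc $a=(u,u')\in A^\pi_i$ (in any order): let $\operatorname{cand}=\operatorname{rep}[u]+\chi(a)$; if $\operatorname{rep}[u']$ is undefined, set $\operatorname{rep}[u']=\operatorname{cand}$; otherwise add the vector $\operatorname{cand}-\operatorname{rep}[u']$ to $\mathcal{M}$. Return $\operatorname{rank}(\mathcal{M})$, the dimension of the linear span of $\mathcal{M}$ (equal to $0$ if $\mathcal{M}=\emptyset$). The dimension of a polytope is its affine dimension. *)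

(* Defs.v *)
From HB Require Import structures.
From mathcomp Require Import all_boot all_order all_algebra.
From mathcomp Require Import boolp classical_sets reals.

Set Implicit Arguments.
Unset Strict Implicit.
Unset Printing Implicit Defensive.

Import Order.TTheory GRing.Theory Num.Theory.

Local Open Scope ring_scope.
Local Open Scope classical_set_scope.

(* Layers and variables are indexed from 0: the node layers are 0, ..., n (root
   layer 0, terminal layer n), and an arc on variable i : 'I_n goes from layer
   i to layer i + 1. Arcs form a type of their own, so parallel arcs with
   different labels are allowed. *)
Record decision_diagram (n : nat) := DecisionDiagram {
  dd_node : finType;
  dd_arc : finType;
  dd_layer : dd_node -> 'I_n.+1;
  dd_root : dd_node;
  dd_term : dd_node;
  dd_tail : dd_arc -> dd_node;
  dd_head : dd_arc -> dd_node;
  dd_var : dd_arc -> 'I_n;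
  dd_val : dd_arc -> bool;
  dd_layer_root : forall u, ((dd_layer u : nat) = 0)%N <-> u = dd_root;
  dd_layer_term : forall u, (dd_layer u : nat) = n <-> u = dd_term;
  dd_layer_tail : forall a, (dd_layer (dd_tail a) : nat) = dd_var a;
  dd_layer_head : forall a, (dd_layer (dd_head a) : nat) = (dd_var a).+1;
  dd_deterministic : forall a b,
    dd_tail a = dd_tail b -> dd_val a = dd_val b -> a = b
}.

Section Vectors.
Variables (R : realType) (n : nat).
Implicit Types (z : 'rV[R]_n) (S : set 'rV[R]_n).

Definition dotv (pi z : 'rV[R]_n) : R := \sum_(i < n) pi 0 i * z 0 i.

Definition binary_points : set 'rV[R]_n :=
  [set z | forall i, z 0 i = 0 \/ z 0 i = 1].

Definition conv_hull S : set 'rV[R]_n :=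
  [set z | exists (k : nat) (x : 'I_k -> 'rV[R]_n) (w : 'I_k -> R),
     [/\ forall i, S (x i), forall i, 0 <= w i, \sum_(i < k) w i = 1
       & z = \sum_(i < k) w i *: x i]].

Definition aff_hull S : set 'rV[R]_n :=
  [set z | exists (k : nat) (x : 'I_k -> 'rV[R]_n) (w : 'I_k -> R),
     [/\ forall i, S (x i), \sum_(i < k) w i = 1
       & z = \sum_(i < k) w i *: x i]].

(* The affine hull of S is a translate of a linear subspace of dimension d.
   The empty set has no dimension in this sense. *)
Definition has_affine_dim S (d : nat) : Prop :=
  exists (z0 : 'rV[R]_n) (U : {vspace 'rV[R]_n}),
    aff_hull S = [set z0 + u | u in [set u | u \in U]] /\ \dim U = d.

Lemma has_affine_dim_unique S d d' :
  has_affine_dim S d -> has_affine_dim S d' -> d = d'.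
Proof.
move=> [x [U [SU <-]]] [y [V [SV <-]]].
have UV (x1 x2 : 'rV[R]_n) (U1 U2 : {vspace 'rV[R]_n}) :
    [set x1 + u | u in [set u | u \in U1]] =
    [set x2 + u | u in [set u | u \in U2]] -> (U1 <= U2)%VS.
  move=> E; apply/subvP => u uU1.
  have [a aU2 Ea] : [set x2 + v | v in [set v | v \in U2]] (x1 + u).
    by rewrite -E; exists u.
  have [b bU2 Eb] : [set x2 + v | v in [set v | v \in U2]] x1.
    by rewrite -E; exists 0; rewrite ?addr0 //=; exact: mem0v.
  have -> : u = a - b.
    by rewrite -[u](addKr x1) -Ea -{1}Eb opprD addrACA addNr add0r addrC.
  exact: memvB.
congr (\dim _); apply/eqP; rewrite eqEsubv; apply/andP.
by split; [apply: (UV x y)|apply: (UV y x)]; rewrite -SU -SV.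
Qed.

Definition valid_ineq S (pi : 'rV[R]_n) (pi0 : R) : Prop :=
  forall z, S z -> dotv pi z <= pi0.

Definition face S (pi : 'rV[R]_n) (pi0 : R) : set 'rV[R]_n :=
  [set z | S z /\ dotv pi z = pi0].

End Vectors.

Section Diagrams.
Variables (R : realType) (n : nat) (B : decision_diagram n).
Implicit Types (a : dd_arc B) (p : n.-tuple (dd_arc B)).

Fixpoint dd_walk (u : dd_node B) (s : seq (dd_arc B)) (v : dd_node B) : bool :=
  if s is a :: s' then (dd_tail a == u) && dd_walk (dd_head a) s' v
  else u == v.

Definition rt_path p : bool := dd_walk (dd_root B) p (dd_term B).

Definition path_point p : 'rV[R]_n :=
  \row_(i < n) (dd_val (tnth p i))%:R.

Definition exactly_represents (Q : set 'rV[R]_n) : Prop :=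
  [set path_point p | p in [set p | rt_path p]] = Q.

Definition arc_vec a : 'rV[R]_n :=
  if dd_val a then delta_mx 0 (dd_var a) else 0.

Variables (pi : 'rV[R]_n) (pi0 : R).

Definition arc_length a : R := dotv pi (arc_vec a).

Definition tight_path p : bool :=
  rt_path p && (\sum_(a <- p) arc_length a == pi0).

Definition tight_arc a : bool :=
  [exists p : n.-tuple (dd_arc B), tight_path p && (a \in p)].

(* The arcs of A^pi_i, listed in the order they have in ord. When ord ranges
   over the enumerations of all arcs, these lists range over all simultaneous
   choices of an order on each A^pi_i. *)
Definition tight_arcs (ord : seq (dd_arc B)) (i : 'I_n) : seq (dd_arc B) :=
  [seq a <- ord | tight_arc a && (dd_var a == i)].

(* The array rep (None when undefined) and the collection M. The array is
   indexed by all nodes, but only its entries at the root and at heads of tight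
   arcs are ever set. *)
Record dd_state := DDState {
  dd_rep : dd_node B -> option 'rV[R]_n;
  dd_vectors : seq 'rV[R]_n
}.

Definition dd_init : dd_state :=
  DDState (fun u => if u == dd_root B then Some 0 else None) [::].

(* Reading an undefined entry rep[u] at the tail u of a makes the whole run
   fail (None) instead of using a default value. *)
Definition dd_step (st : dd_state) a : option dd_state :=
  if dd_rep st (dd_tail a) is Some ru then
    let cand := ru + arc_vec a in
    if dd_rep st (dd_head a) is Some rv then
      Some (DDState (dd_rep st) (rcons (dd_vectors st) (cand - rv)))
    else
      Some (DDState
        (fun u => if u == dd_head a then Some cand else dd_rep st u)
        (dd_vectors st))
  else None.

Definition dd_run (s : seq (dd_arc B)) : option dd_state :=
  foldl (fun st a => obind (dd_step^~ a) st) (Some dd_init) s.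

Definition DD_DimensionCertificate (ord : seq (dd_arc B)) : option nat :=
  omap (fun st => \dim <<dd_vectors st>>%VS)
       (dd_run (flatten [seq tight_arcs ord i | i <- enum 'I_n])).

End Diagrams.

Arguments binary_points R n : clear implicits.
Arguments DD_DimensionCertificate {R n} B pi pi0 ord.

(* Main.v *)
Require Import Defs.
From mathcomp Require Import all_boot all_order all_algebra.
From mathcomp Require Import boolp classical_sets reals.
From mathcomp Require Import lra.

Set Implicit Arguments.
Unset Strict Implicit.
Unset Printing Implicit Defensive.

Import Order.TTheory GRing.Theory Num.Theory.

Local Open Scope ring_scope.
Local Open Scope classical_set_scope.

(** Since the inequality is valid on conv(Q), a convex combination attains pi0
only if every point carrying weight does, so the face is the convex hull of
the set T of points of tight root-terminal paths. Its dimension is thus that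
of the linear span D of the differences of points of T, and the claim is that
D is the span of the collection M built by the algorithm
([has_affine_dim_span]).

Both inclusions rest on an exchange argument. If two tight paths meet at a
node u, swapping their parts after u gives two paths whose lengths add up to
2 * pi0; neither exceeds pi0, so both are tight ([tight_walk_exchange]). It
follows that any walk from the root along tight arcs, even if its arcs come
from different tight paths, is the beginning of a tight path, and that two
such walks to the same node can be completed by the same arcs
([tight_arcs_common_extension]).

- M lies in D: every entry rep[u] is the sum of the arc vectors of a walk of
  tight arcs from the root to u, so a vector put into M is the difference of
  two such sums for walks to the same node. A common completion cancels in the
  difference, which is therefore a difference of points of T.
- D lies in span(M): every tight arc a = (u, u') satisfies
  rep[u] + chi(a) - rep[u'] in span(M), this vector being 0 if a is the arc
  that defines rep[u'] and an element of M otherwise. Telescoping along a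
  tight path, its point is congruent to rep[t] modulo span(M)
  ([run_invariant_walk]).

That the run never reads an undefined entry is a matter of order: a tight arc
not leaving the root has a predecessor on a tight path, whose variable is
smaller and which is therefore processed before it ([tight_arcs_pred]). *)

(** * Convex hulls, faces and affine dimension *)

Section AffineGeometry.
Variables (R : realType) (n : nat).
Implicit Types (pi z x y : 'rV[R]_n) (S T : set 'rV[R]_n).

Lemma dotvD pi x y : dotv pi (x + y) = dotv pi x + dotv pi y.
Proof.
by rewrite -big_split /=; apply: eq_bigr => i _; rewrite mxE mulrDr.
Qed.

Lemma dotvZ pi c x : dotv pi (c *: x) = c * dotv pi x.
Proof.
by rewrite /dotv mulr_sumr; apply: eq_bigr => i _; rewrite mxE mulrCA.
Qed.

Lemma dotv_sum pi (I : Type) (r : seq I) (F : I -> 'rV[R]_n) :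
  dotv pi (\sum_(i <- r) F i) = \sum_(i <- r) dotv pi (F i).
Proof.
apply: (big_morph (dotv pi) (dotvD pi)).
by rewrite /dotv big1 // => i _; rewrite mxE mulr0.
Qed.

Lemma sub_conv_hull S : S `<=` conv_hull S.
Proof.
move=> z Sz; exists 1%N, (fun=> z), (fun=> 1).
by split=> //; rewrite big_ord1 ?scale1r.
Qed.

Lemma face_sub S T pi (pi0 : R) : S `<=` T -> face S pi pi0 `<=` face T pi pi0.
Proof. by move=> ST z [/ST Tz zpi]. Qed.

(** In a convex combination that attains pi0, the slacks pi0 - pi.x_i are
nonnegative with weighted sum 0, so each x_i of nonzero weight attains pi0. *)
Lemma face_conv_hull S pi (pi0 : R) :
    valid_ineq S pi pi0 ->
  face (conv_hull S) pi pi0 `<=` conv_hull (face S pi pi0).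
Proof.
move=> Svalid z [[k [x [w [Sx w0 w1 zE]]]] zpi].
have slack i : w i * (pi0 - dotv pi (x i)) = 0.
  apply: (psumr_eq0P (P := xpredT)
    (F := fun i => w i * (pi0 - dotv pi (x i)))) => //.
    by move=> j _; rewrite mulr_ge0 // subr_ge0; exact: Svalid.
  under eq_bigr do rewrite mulrBr.
  rewrite sumrB -mulr_suml w1 mul1r -{1}zpi zE dotv_sum.
  by under eq_bigr do rewrite dotvZ; rewrite subrr.
have [i0 wi0] : exists i, w i != 0.
  apply/existsP; apply: contraT; rewrite negb_exists => /forallP w_eq0.
  suff : (1 : R) = 0 by move/eqP; rewrite oner_eq0.
  by rewrite -w1 big1 // => i _; apply/eqP; rewrite -[_ == _]negbK.
have tight i : w i != 0 -> face S pi pi0 (x i).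
  move=> wi; split=> //; move/eqP: (slack i).
  by rewrite mulf_eq0 (negPf wi) subr_eq0 => /eqP.
(* Points of weight 0 may lie off the face, so x i0 takes their place. *)
exists k, (fun i => if w i == 0 then x i0 else x i), w; split=> //.
  by move=> i; case: (boolP (w i == 0)) => [_|]; apply: tight.
rewrite zE; apply: eq_bigr => i _.
by case: eqP => [->|//]; rewrite !scale0r.
Qed.

Lemma affine_combination_sub S z0 (U : {vspace 'rV[R]_n}) k
    (x : 'I_k -> 'rV[R]_n) (w : 'I_k -> R) :
    (forall y, S y -> y - z0 \in U) ->
    (forall i, S (x i)) -> \sum_(i < k) w i = 1 ->
  \sum_(i < k) w i *: x i - z0 \in U.
Proof.
move=> SU Sx w1; rewrite -[z0]scale1r -w1 scaler_suml -sumrB.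
by apply: memv_suml => i _; rewrite -scalerBr memvZ // SU.
Qed.

(** The point x receives the extra weight c and y the extra weight -c, so the
total weight is still 1. *)
Lemma aff_hull_translate S z x y c :
  aff_hull S z -> S x -> S y -> aff_hull S (z + c *: (x - y)).
Proof.
have add_point k (p : 'I_k -> 'rV[R]_n) (w : 'I_k -> R) q d :
    (forall i, S (p i)) -> S q ->
    exists (p' : 'I_k.+1 -> 'rV[R]_n) (w' : 'I_k.+1 -> R),
      [/\ forall i, S (p' i), \sum_i w' i = d + \sum_i w i
        & \sum_i w' i *: p' i = d *: q + \sum_i w i *: p i].
  move=> Sp Sq.
  exists (fun i => oapp p q (unlift ord0 i)).
  exists (fun i => oapp w d (unlift ord0 i)).
  split=> [i||]; first by case: (unlift ord0 i).
    by rewrite big_ord_recl unlift_none; under eq_bigr do rewrite liftK.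
  by rewrite big_ord_recl unlift_none; under eq_bigr do rewrite !liftK.
move=> [k [p [w [Sp w1 ->]]]] Sx Sy.
have [p1 [v1 [Sp1 s1 e1]]] := add_point k p w x c Sp Sx.
have [p2 [v2 [Sp2 s2 e2]]] := add_point _ p1 v1 y (- c) Sp1 Sy.
exists k.+2, p2, v2; split=> //; first by rewrite s2 s1 w1 addKr.
by rewrite e2 e1 scalerBr scaleNr addrA [RHS]addrC [X in _ = X + _]addrC.
Qed.

(** The second hypothesis puts the differences from z0 into the span of M, the
third puts the translate by z0 of that span into the affine hull of S. *)
Lemma has_affine_dim_span S z0 (M : seq 'rV[R]_n) :
    S z0 -> (forall x, S x -> x - z0 \in <<M>>%VS) ->
    (forall m, m \in M -> exists x y, [/\ S x, S y & m = x - y]) ->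
  has_affine_dim S (\dim <<M>>%VS).
Proof.
move=> Sz0 SM MS; exists z0, <<M>>%VS; split=> //.
apply/seteqP; split=> z /=.
  move=> [k [x [w [Sx w1 ->]]]]; exists (\sum_(i < k) w i *: x i - z0).
    exact: affine_combination_sub SM Sx w1.
  by rewrite addrC subrK.
move=> [u uM <-]; rewrite (coord_span (X := in_tuple M) uM).
apply: (big_rec (fun v => aff_hull S (z0 + v))) => [|i v _ Sv].
  rewrite addr0; exists 1%N, (fun=> z0), (fun=> 1).
  by split=> //; rewrite big_ord1 ?scale1r.
have [//|x [y [Sx Sy ->]]] := MS (in_tuple M)`_i; first by rewrite mem_nth.
by rewrite [_ + v]addrC addrA; apply: aff_hull_translate.
Qed.

End AffineGeometry.

(** * Walks in a decision diagram *)

Section Walks.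
Variables (R : realType) (n : nat) (B : decision_diagram n).
Implicit Types (u v : dd_node B) (s : seq (dd_arc B)) (a : dd_arc B).

Definition walk_point s : 'rV[R]_n := \sum_(a <- s) arc_vec R a.

Lemma walk_point_cat s1 s2 :
  walk_point (s1 ++ s2) = walk_point s1 + walk_point s2.
Proof. exact: big_cat. Qed.

Lemma walk_point_rcons s a : walk_point (rcons s a) = walk_point s + arc_vec R a.
Proof. by rewrite -cats1 walk_point_cat [walk_point [:: a]]big_seq1. Qed.

Lemma sum_arc_length pi s :
  \sum_(a <- s) arc_length pi a = dotv pi (walk_point s).
Proof. by rewrite dotv_sum. Qed.

Lemma dd_walk_cat u s1 v s2 t :
  dd_walk u s1 v -> dd_walk v s2 t -> dd_walk u (s1 ++ s2) t.
Proof.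
elim: s1 u => [|a s1 IH] u /=; first by move/eqP->.
by case/andP=> -> /IH; apply.
Qed.

Lemma dd_walk_catP u s1 s2 t :
  dd_walk u (s1 ++ s2) t -> exists2 v, dd_walk u s1 v & dd_walk v s2 t.
Proof.
elim: s1 u => [|a s1 IH] u /=; first by exists u.
by case/andP=> -> /IH.
Qed.

Lemma dd_walk_rcons u s a v :
  dd_walk u (rcons s a) v = dd_walk u s (dd_tail a) && (dd_head a == v).
Proof.
elim: s u => [|b s IH] u /=; last by rewrite IH andbA.
by rewrite [u == _]eq_sym.
Qed.

Lemma dd_walk_layer u s v :
  dd_walk u s v -> (dd_layer v : nat) = (dd_layer u + size s)%N.
Proof.
elim/last_ind: s v => [|s a IH] v /=; first by move/eqP->; rewrite addn0.
rewrite dd_walk_rcons => /andP[/IH + /eqP <-].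
by rewrite dd_layer_head dd_layer_tail size_rcons addnS => ->.
Qed.

Lemma dd_walk_size s : dd_walk (dd_root B) s (dd_term B) -> size s = n.
Proof.
move/dd_walk_layer.
have /dd_layer_root -> : dd_root B = dd_root B by [].
by have /dd_layer_term -> : dd_term B = dd_term B by [].
Qed.

Lemma dd_walk_var u s v i a0 :
  dd_walk u s v -> (i < size s)%N ->
  (dd_var (nth a0 s i) : nat) = (dd_layer u + i)%N.
Proof.
elim: s u i => [//|a s IH] u [|i] /= /andP[/eqP <- aw] lti.
  by rewrite addn0 dd_layer_tail.
by rewrite (IH _ _ aw lti) dd_layer_head dd_layer_tail addSnnS.
Qed.

(** The arc in position i of a root-terminal path has variable i, so adding up
    the arc vectors fills in one coordinate at a time. *)
Lemma path_pointE (p : n.-tuple (dd_arc B)) :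
  rt_path p -> path_point R p = walk_point p.
Proof.
move=> pw; have varE i : dd_var (tnth p i) = i.
  apply: val_inj => /=; rewrite (tnth_nth (tnth p i)).
  rewrite (dd_walk_var _ pw) ?size_tuple //.
  by have /dd_layer_root -> : dd_root B = dd_root B by [].
apply/rowP => j; rewrite mxE /walk_point big_tuple summxE (bigD1 j) //=.
rewrite big1 => [|i ij]; rewrite /arc_vec varE.
  by rewrite addr0; case: (dd_val _); rewrite mxE ?eqxx.
by case: (dd_val _); rewrite mxE // [j == i]eq_sym (negPf ij).
Qed.

End Walks.

(** * Tight walks *)

Section TightWalks.
Variables (R : realType) (n : nat) (B : decision_diagram n).
Variables (pi : 'rV[R]_n) (pi0 : R).
Implicit Types (u v : dd_node B) (s w : seq (dd_arc B)) (a : dd_arc B).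

Definition tight_walk s :=
  dd_walk (dd_root B) s (dd_term B) /\ dotv pi (walk_point R s) = pi0.

Lemma tight_pathP (p : n.-tuple (dd_arc B)) :
  reflect (tight_walk p) (tight_path pi pi0 p).
Proof.
by apply: (iffP andP); rewrite sum_arc_length => -[rp /eqP len].
Qed.

Lemma tight_walk_path s :
  tight_walk s -> exists2 p : n.-tuple (dd_arc B), tight_path pi pi0 p & s = p.
Proof.
move=> sw; have sn : size s == n by rewrite (dd_walk_size sw.1).
by exists (Tuple sn) => //; apply/tight_pathP.
Qed.

Lemma tight_walk_arc s a : tight_walk s -> a \in s -> tight_arc pi pi0 a.
Proof.
case/tight_walk_path => p pt -> ap.
by apply/existsP; exists p; rewrite pt.
Qed.

Lemma tight_arcP a :
  tight_arc pi pi0 a -> exists s1 s2, tight_walk (s1 ++ a :: s2).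
Proof.
case/existsP=> p /andP[/tight_pathP + ap].
case/splitPr: ap => s1 s2 pw.
by exists s1, s2.
Qed.

(** Validity of the inequality, read on the root-terminal paths of the
diagram. *)
Definition short_walks :=
  forall s, dd_walk (dd_root B) s (dd_term B) -> dotv pi (walk_point R s) <= pi0.

(** The two exchanged paths w1 ++ s2 and w2 ++ s1 have lengths of sum 2 * pi0,
and neither is longer than pi0. *)
Lemma tight_walk_exchange u w1 s1 w2 s2 :
    short_walks ->
    dd_walk (dd_root B) w1 u -> dd_walk u s1 (dd_term B) ->
    dd_walk (dd_root B) w2 u -> dd_walk u s2 (dd_term B) ->
    tight_walk (w1 ++ s1) -> tight_walk (w2 ++ s2) ->
  tight_walk (w1 ++ s2).
Proof.
move=> short w1u s1t w2u s2t [_ t11] [_ t22]; split; first exact: dd_walk_cat w1u s2t.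
have l12 := short _ (dd_walk_cat w1u s2t).
have l21 := short _ (dd_walk_cat w2u s1t).
move: t11 t22 l12 l21; rewrite !walk_point_cat !dotvD => t11 t22 l12 l21.
lra.
Qed.

(** Arc by arc: if w extends to a tight path and the arc a continuing w lies on
another tight path, exchanging the two at the tail of a makes w followed by a
extend as well. The tight path s0 is what the empty walk extends to. *)
Lemma tight_arcs_extend s0 w u :
    short_walks -> tight_walk s0 ->
    dd_walk (dd_root B) w u -> {in w, forall a, tight_arc pi pi0 a} ->
  exists2 s, dd_walk u s (dd_term B) & tight_walk (w ++ s).
Proof.
move=> short s0t; elim/last_ind: w u => [|w a IH] u.
  by move=> /= /eqP <- _; exists s0 => //; case: s0t.
rewrite dd_walk_rcons => /andP[wa /eqP <-] wt.
have [s2 s2t ws2] : exists2 s, dd_walk (dd_tail a) s (dd_term B)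
    & tight_walk (w ++ s).
  by apply: IH wa _ => b bw; apply: wt; rewrite mem_rcons inE bw orbT.
have [s1 [s3 s1as3]] : exists s1 s2, tight_walk (s1 ++ a :: s2).
  by apply/tight_arcP/wt; rewrite mem_rcons inE eqxx.
have [v s1v as3] := dd_walk_catP s1as3.1.
have /= /andP[/eqP tav s3t] := as3; rewrite -{}tav in s1v as3.
exists s3; first exact: s3t.
rewrite cat_rcons.
exact: tight_walk_exchange short wa s2t s1v as3 ws2 s1as3.
Qed.

Lemma tight_arcs_common_extension s0 w1 w2 u :
    short_walks -> tight_walk s0 ->
    dd_walk (dd_root B) w1 u -> {in w1, forall a, tight_arc pi pi0 a} ->
    dd_walk (dd_root B) w2 u -> {in w2, forall a, tight_arc pi pi0 a} ->
  exists2 s, tight_walk (w1 ++ s) & tight_walk (w2 ++ s).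
Proof.
move=> short s0t w1u w1t w2u w2t.
have [s1 s1t ws1] := tight_arcs_extend short s0t w1u w1t.
have [s2 s2t ws2] := tight_arcs_extend short s0t w2u w2t.
exists s2 => //.
exact: tight_walk_exchange short w1u s1t w2u s2t ws1 ws2.
Qed.

End TightWalks.

(** * Runs of the algorithm *)

Section Runs.
Variables (R : realType) (n : nat) (B : decision_diagram n).
Implicit Types (u v : dd_node B) (s w : seq (dd_arc B)) (a b : dd_arc B).
Implicit Types (st : dd_state R B).

(** What holds once the arcs of s are processed. [inv_rep] and [inv_vectors]
record where the vectors come from, which bounds the span of the collection
from above; [inv_arc] bounds it from below. *)
Record run_invariant s st : Prop := RunInvariant {
  inv_root : dd_rep st (dd_root B) = Some 0;
  inv_rep : forall u ru, dd_rep st u = Some ru ->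
    exists w, [/\ {subset w <= s}, dd_walk (dd_root B) w u
                & walk_point R w = ru];
  inv_arc : forall a, a \in s -> exists ru rv,
    [/\ dd_rep st (dd_tail a) = Some ru, dd_rep st (dd_head a) = Some rv
      & ru + arc_vec R a - rv \in <<dd_vectors st>>%VS];
  inv_vectors : forall m, m \in dd_vectors st -> exists u w1 w2,
    [/\ {subset w1 <= s} /\ {subset w2 <= s}, dd_walk (dd_root B) w1 u,
        dd_walk (dd_root B) w2 u & m = walk_point R w1 - walk_point R w2]
}.

Lemma run_invariant_init : run_invariant [::] (dd_init R B).
Proof.
split=> //=; first by rewrite eqxx.
move=> u ru; case: eqP => // -> [<-]; exists [::].
by rewrite /walk_point big_nil /= eqxx.
Qed.

Lemma run_invariant_step s st a ru :
    run_invariant s st -> dd_rep st (dd_tail a) = Some ru ->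
  exists2 st', dd_step st a = Some st' & run_invariant (rcons s a) st'.
Proof.
move=> [iroot irep iarc ivec] tailE.
have widen w : {subset w <= s} -> {subset w <= rcons s a}.
  by move=> ws b /ws; rewrite mem_rcons inE orbC => ->.
have [wu [wus wuw wuE]] := irep _ _ tailE.
have wua : {subset rcons wu a <= rcons s a}.
  move=> b; rewrite !mem_rcons !inE => /orP[->//|/wus ->].
  by rewrite orbT.
have wuaw : dd_walk (dd_root B) (rcons wu a) (dd_head a).
  by rewrite dd_walk_rcons wuw eqxx.
have wuaE : walk_point R (rcons wu a) = ru + arc_vec R a.
  by rewrite walk_point_rcons wuE.
rewrite /dd_step tailE; case headE: (dd_rep st (dd_head a)) => [rv|]; last first.
  have other u rx : dd_rep st u = Some rx -> (u == dd_head a) = false.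
    by move=> uE; apply/eqP => uh; rewrite uh headE in uE.
  eexists; first by []; split=> /=.
  - by rewrite (other _ _ iroot).
  - move=> u rx; case: eqP => [-> [<-]|_ /irep[w [ws ww wE]]].
      by exists (rcons wu a).
    by exists w; split=> //; apply: widen.
  - move=> b; rewrite mem_rcons inE => /predU1P[->|/iarc[rx [ry [xE yE xy]]]].
      exists ru, (ru + arc_vec R a).
      by rewrite eqxx (other _ _ tailE) subrr mem0v.
    by exists rx, ry; rewrite (other _ _ xE) (other _ _ yE).
  - move=> m /ivec[u [w1 [w2 [[ws1 ws2] ww1 ww2 ->]]]].
    by exists u, w1, w2; split=> //; split; apply: widen.
have [wv [wvs wvw wvE]] := irep _ _ headE.
eexists; first by []; split=> //=.
- move=> u rx /irep[w [ws ww wE]].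
  by exists w; split=> //; apply: widen.
- move=> b; rewrite mem_rcons inE => /predU1P[->|/iarc[rx [ry [xE yE xy]]]].
    by exists ru, rv; split=> //; rewrite memv_span // mem_rcons inE eqxx.
  exists rx, ry; split=> //; apply: subvP xy; apply: sub_span => m mM.
  by rewrite mem_rcons inE mM orbT.
- move=> m; rewrite mem_rcons inE => /predU1P[->|/ivec].
    exists (dd_head a), (rcons wu a), wv; split=> //; last by rewrite wuaE wvE.
    by split=> //; apply: widen.
  move=> [u [w1 [w2 [[ws1 ws2] ww1 ww2 ->]]]].
  by exists u, w1, w2; split=> //; split; apply: widen.
Qed.

Lemma dd_run_rcons s a : 
  dd_run R (rcons s a) = obind (fun st => dd_step st a) (dd_run R s).
Proof. exact: foldl_rcons. Qed.

(** The hypothesis says that every arc leaves the root or a node entered by an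
earlier arc; it is what makes each access to a representative succeed. *)
Lemma dd_run_invariant s :
    (forall s1 a s2, s = s1 ++ a :: s2 ->
      dd_tail a = dd_root B \/ exists2 b, b \in s1 & dd_head b = dd_tail a) ->
  exists2 st, dd_run R s = Some st & run_invariant s st.
Proof.
elim/last_ind: s => [|s a IH] pred.
  by exists (dd_init R B) => //; exact: run_invariant_init.
have [|st runE inv] := IH.
  move=> s1 b s2 sE; apply: (pred s1 b (rcons s2 a)).
  by rewrite sE rcons_cat rcons_cons.
have [ru tailE] : exists ru, dd_rep st (dd_tail a) = Some ru.
  have [|->|[b bs <-]] := pred s a [::]; first by rewrite cats1.
    by exists 0; exact: inv_root inv.
  by have [_ [rv [_ ? _]]] := inv_arc inv bs; exists rv.
have [st' stepE inv'] := run_invariant_step inv tailE.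
by exists st' => //; rewrite dd_run_rcons runE.
Qed.

(** The relations [inv_arc] of consecutive arcs telescope. *)
Lemma run_invariant_walk s st u ru w v :
    run_invariant s st -> dd_rep st u = Some ru ->
    {subset w <= s} -> dd_walk u w v ->
  exists2 rv, dd_rep st v = Some rv
    & ru + walk_point R w - rv \in <<dd_vectors st>>%VS.
Proof.
move=> inv; elim: w u ru => [|a w IH] u ru uE ws /=.
  move/eqP=> <-; exists ru => //.
  by rewrite /walk_point big_nil addr0 subrr mem0v.
case/andP=> /eqP tE aw.
have [|ru' [rx [tailE headE arcM]]] := inv_arc inv (a := a).
  by apply: ws; rewrite inE eqxx.
have {tailE} ru'E : ru' = ru by move: tailE; rewrite tE uE => -[].
have [b bw|rv rvE wM] := IH _ _ headE _ aw.
  by apply: ws; rewrite inE bw orbT.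
exists rv => //; rewrite ru'E in arcM.
rewrite /walk_point big_cons.
have -> : ru + (arc_vec R a + \sum_(b <- w) arc_vec R b) - rv =
    (ru + arc_vec R a - rx) + (rx + walk_point R w - rv).
  by rewrite !addrA subrK.
exact: memvD.
Qed.

End Runs.

(** * Processing the tight arcs layer by layer *)

Section Order.
Variables (R : realType) (n : nat) (B : decision_diagram n).
Variables (pi : 'rV[R]_n) (pi0 : R) (ord : seq (dd_arc B)).
Hypothesis ordP : perm_eq ord (enum (dd_arc B)).

Let arcs := flatten [seq tight_arcs pi pi0 ord i | i <- enum 'I_n].

Lemma mem_tight_arcs a : (a \in arcs) = tight_arc pi pi0 a.
Proof.
apply/flatten_mapP/idP => [[i _]|at_].
  by rewrite mem_filter => /andP[/andP[]].
exists (dd_var a); first by rewrite mem_enum.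
by rewrite mem_filter at_ eqxx (perm_mem ordP) mem_enum.
Qed.

Lemma tight_arcs_ordered s1 a s2 b :
  arcs = s1 ++ a :: s2 -> b \in s2 -> (dd_var a <= dd_var b)%N.
Proof.
rewrite /arcs => arcsE bs2.
have : pairwise (fun a b => dd_var a <= dd_var b)%N arcs.
  have : pairwise leq [seq val i | i <- enum 'I_n].
    by rewrite val_enum_ord -sorted_pairwise ?iota_sorted //; exact: leq_trans.
  rewrite /arcs pairwise_map; elim: (enum _) => [//|i l IH] /= /andP[il /IH {}IH].
  rewrite pairwise_cat IH andbT; apply/andP; split.
    apply/allrelP => x y; rewrite mem_filter => /andP[/andP[_ /eqP ->] _].
    case/flatten_mapP => j jl; rewrite mem_filter => /andP[/andP[_ /eqP ->] _].
    exact: (allP il).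
  apply: (@sub_in_pairwise _ [pred x | dd_var x == i] (fun _ _ => true)).
  - by move=> x y /eqP -> /eqP ->.
  - by apply/allP => x; rewrite mem_filter => /andP[/andP[]].
  by elim: (tight_arcs _ _ _ _) => //= ? ? ->; rewrite all_predT.
rewrite /arcs arcsE pairwise_cat /= => /and3P[_ _ /andP[/allP]].
by move=> /(_ _ bs2).
Qed.

(** The arc b that precedes a on a tight path is tight, so it is processed; as
its variable is one less than that of a, it cannot come after a. *)
Lemma tight_arcs_pred s1 a s2 :
    arcs = s1 ++ a :: s2 ->
  dd_tail a = dd_root B \/ exists2 b, b \in s1 & dd_head b = dd_tail a.
Proof.
move=> arcsE.
have : a \in arcs by rewrite arcsE mem_cat inE eqxx orbT.
rewrite mem_tight_arcs => /tight_arcP[p1 [p2 pt]].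
have [v p1v /= /andP[/eqP tav _]] := dd_walk_catP pt.1; rewrite -tav in p1v.
case/lastP: p1 => [|p1 b] in pt p1v *; first by left; apply/esym/eqP.
right; exists b; last by move: p1v; rewrite dd_walk_rcons => /andP[_ /eqP].
have : b \in arcs.
  rewrite mem_tight_arcs; apply: tight_walk_arc pt _.
  by rewrite mem_cat mem_rcons inE eqxx.
have varE : (dd_var a : nat) = (dd_var b).+1.
  rewrite -dd_layer_tail -dd_layer_head.
  by move: p1v; rewrite dd_walk_rcons => /andP[_ /eqP ->].
rewrite arcsE mem_cat inE => /or3P[//|/eqP ba|bs2].
  by move: varE; rewrite ba => /eqP; rewrite -[X in X == _]addn0 -addn1 eqn_add2l.
by have := tight_arcs_ordered arcsE bs2; rewrite varE ltnn.
Qed.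

End Order.

(** * Dimension of the face *)

Theorem theorem2 (R : realType) (n : nat) (Q : set 'rV[R]_n)
    (B : decision_diagram n) (pi : 'rV[R]_n) (pi0 : R)
    (Qbin : Q `<=` binary_points R n)
    (BQ : exactly_represents B Q)
    (valid : valid_ineq (conv_hull Q) pi pi0)
    (Fne : face (conv_hull Q) pi pi0 !=set0)
    (ord : seq (dd_arc B))
    (ordP : perm_eq ord (enum (dd_arc B))) :
  exists2 d : nat,
    DD_DimensionCertificate B pi pi0 ord = Some d
    & has_affine_dim (face (conv_hull Q) pi pi0) d.
Proof.
have Qvalid : valid_ineq Q pi pi0 by move=> z /sub_conv_hull /valid.
have Qface := face_conv_hull Qvalid.
have faceP z : face Q pi pi0 z <->
    exists2 s : seq (dd_arc B), tight_walk pi pi0 s & z = walk_point R s.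
  split=> [[]|[s st ->]].
    rewrite -BQ => -[p pw <-]; rewrite path_pointE // => len.
    by exists p.
  have [p /andP[pw _] sp] := tight_walk_path st.
  split; last exact: st.2.
  by rewrite -BQ sp -path_pointE //; exists p.
have faceS (s : seq (dd_arc B)) :
    tight_walk pi pi0 s -> face (conv_hull Q) pi pi0 (walk_point R s).
  by move=> st; apply: face_sub (@sub_conv_hull _ _ Q) _ _; apply/faceP; exists s.
have short : short_walks B pi pi0.
  move=> s sw; have sn : size s == n by rewrite (dd_walk_size sw).
  apply: Qvalid; rewrite -BQ; exists (Tuple sn) => //.
  exact: path_pointE.
have [z0 Qz0] : exists z0, face Q pi pi0 z0.
  have [z /Qface[k [x [w [Qx _ w1 _]]]]] := Fne.
  case: k x w Qx w1 => [|k] x w Qx w1; last by exists (x ord0).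
  by move/eqP: w1; rewrite big_ord0 eq_sym oner_eq0.
have [s0 s0t z0E] := (faceP z0).1 Qz0.
have [st runE inv] :=
  dd_run_invariant R (tight_arcs_pred (pi := pi) (pi0 := pi0) ordP).
exists (\dim <<dd_vectors st>>%VS).
  by rewrite /DD_DimensionCertificate runE.
apply: (has_affine_dim_span (z0 := z0)).
- by rewrite z0E; exact: faceS.
- move=> x /Qface[k [y [w [Qy _ w1 ->]]]].
  apply: affine_combination_sub Qy w1 => _ /faceP[s st_ ->].
  (* The points of s and s0 are both congruent to the representative of the
   terminal, so their difference lies in the span. *)
  have walkM (p : seq (dd_arc B)) : tight_walk pi pi0 p -> exists2 rv,
      dd_rep st (dd_term B) = Some rv
      & 0 + walk_point R p - rv \in <<dd_vectors st>>%VS.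
    move=> pt; apply: run_invariant_walk inv (inv_root inv) _ pt.1 => a ap.
    by rewrite mem_tight_arcs //; apply: tight_walk_arc pt ap.
  have [rv rvE] := walkM _ st_; rewrite add0r => sM.
  have [rv' ] := walkM _ s0t; rewrite rvE add0r => -[<-] s0M.
  by rewrite z0E; have := memvB sM s0M; rewrite opprB addrA subrK.
- move=> m /(inv_vectors inv)[u [w1 [w2 [[ws1 ws2] w1u w2u ->]]]].
  have [||s t1 t2] := tight_arcs_common_extension short s0t w1u _ w2u _.
  - by move=> a /ws1; rewrite mem_tight_arcs.
  - by move=> a /ws2; rewrite mem_tight_arcs.
  exists (walk_point R (w1 ++ s)), (walk_point R (w2 ++ s)).
  split; [exact: faceS | exact: faceS |].
  by rewrite !walk_point_cat opprD addrACA subrr addr0.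
Qed.
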